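(* Let $(X,\mathcal{U})$ be a $T_0$ bicomplete quasi-uniform space generated by a family $\mathcal{D}=\{d_\alpha\}_{\alpha\in A}$ of quasi-pseudometrics. For each $i=1,\dots,n$ let $T_i\colon X\to 2^X$ be a multivalued map with $T_ix\neq\emptyset$ for all $x\in X$, and suppose $T_i$ admits a selector $f_i$ that is a $\mathcal{D}$-contraction; let $x_i^*\in X$ be the unique fixed point of $f_i$ (which exists under these hypotheses). If the selectors $f_1,\dots,f_n$ pairwise commute, then $x_1^*=\cdots=x_n^*=:x^*$, and $x^*$ is a common $\mathcal{U}$-startpoint of $T_1,\dots,T_n$, witnessed for each $i$ by $z_i=x^*\in T_ix^*$.
   Context: $X$ is a non-empty set. A quasi-uniformity on $X$ is a filter $\mathcal{U}$ on $X\times X$ such that every $U\in\mathcal{U}$ contains the diagonal $\Delta_X$ and for every $U\in\mathcal{U}$ there is $V\in\mathcal{U}$ with $V\circ V\subseteq U$, where $V\circ V=\{(x,z):\exists y,\ (x,y)\in V,\ (y,z)\in V\}$. The pair $(X,\mathcal{U})$ is a quasi-uniform space. Put $U^{-1}=\{(x,y):(y,x)\in U\}$. The symmetrisation $\mathcal{U}^s$ is the uniformity generated by the entourages $U\cap U^{-1}$, $U\in\mathcal{U}$. $\mathcal{U}$ is $T_0$ if the preorder $\bigcap\mathcal{U}:=\bigcap_{U\in\mathcal{U}}U$ is antisymmetric. $(X,\mathcal{U})$ is bicomplete if the uniform space $(X,\mathcal{U}^s)$ is complete (every net that is Cauchy for $\mathcal{U}^s$ converges in $\mathcal{U}^s$).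 A quasi-pseudometric on $X$ is a function $d\colon X\times X\to[0,\infty)$ with $d(x,x)=0$ and $d(x,z)\le d(x,y)+d(y,z)$. A family $\mathcal{D}$ of quasi-pseudometrics generates the quasi-uniformity having as subbase the sets $\{(x,y):d(x,y)<\varepsilon\}$, $d\in\mathcal{D}$, $\varepsilon>0$. A self-map $f\colon X\to X$ is a $\mathcal{D}$-contraction if there is a family $\{k_\alpha\}_{\alpha\in A}\subseteq[0,1)$ (allowed to depend on $f$) such that for every $\alpha\in A$ and all $x,y\in X$, $d_\alpha(f(x),f(y))\le k_\alpha d_\alpha(x,y)$ and $d_\alpha(f(y),f(x))\le k_\alpha d_\alpha(y,x)$. A selector of $T\colon X\to 2^X$ is a map $f\colon X\to X$ with $f(x)\in Tx$ for every $x\in X$. A point $x^*$ is a common $\mathcal{U}$-startpoint of $T_1,\dots,T_n\colon X\to 2^X$ witnessed by $z_1,\dots,z_n$ if for each $i$, $z_i\in T_ix^*$ and $(x^*,z_i)\in\bigcap\mathcal{U}$. *)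

(* Defs.v *)
From HB Require Import structures.
From mathcomp Require Import all_boot all_order all_algebra.
From mathcomp Require Import all_classical all_reals.
Set Implicit Arguments.
Unset Strict Implicit.
Unset Printing Implicit Defensive.
Import Order.TTheory GRing.Theory Num.Theory.
Local Open Scope classical_set_scope.
Local Open Scope ring_scope.
Local Open Scope relation_scope.

(* [Filter] does not require properness: over a nonempty [X] it follows from
   the condition on the diagonal. *)
Definition quasi_uniformity (X : Type) (U : set_system (X * X)) : Prop :=
  [/\ Filter U,
      forall V, U V -> diagonal `<=` V &
      forall V, U V -> exists2 W, U W & W \; W `<=` V].

(* The sets [V `&` V^-1] are already closed under finite intersections up to
   inclusion, so the filter they generate consists of their supersets. *)
Definition symmetrisation (X : Type) (U : set_system (X * X)) :
  set_system (X * X) := filter_from U (fun V => V `&` V^-1).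

Definition qu_preorder (X : Type) (U : set_system (X * X)) : set (X * X) :=
  \bigcap_(V in U) V.

Definition qu_T0 (X : Type) (U : set_system (X * X)) : Prop :=
  forall x y, qu_preorder U (x, y) -> qu_preorder U (y, x) -> x = y.

(* [le i j] reads "[j] is beyond [i]"; it need not be antisymmetric. *)
Definition directed_preorder (I : Type) (le : I -> I -> Prop) : Prop :=
  [/\ inhabited I,
      forall i, le i i,
      forall i j k, le i j -> le j k -> le i k &
      forall i j, exists2 k, le i k & le j k].

Definition cauchy_net (X : Type) (E : set_system (X * X))
    (I : Type) (le : I -> I -> Prop) (u : I -> X) : Prop :=
  forall W, E W -> exists i0, forall i j, le i0 i -> le i0 j -> W (u i, u j).

Definition net_cvg_to (X : Type) (E : set_system (X * X))
    (I : Type) (le : I -> I -> Prop) (u : I -> X) (x : X) : Prop :=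
  forall W, E W -> exists i0, forall i, le i0 i -> W (x, u i).

Definition net_complete (X : Type) (E : set_system (X * X)) : Prop :=
  forall (I : Type) (le : I -> I -> Prop) (u : I -> X),
    directed_preorder le -> cauchy_net E le u ->
    exists x, net_cvg_to E le u x.

Definition bicomplete (X : Type) (U : set_system (X * X)) : Prop :=
  net_complete (symmetrisation U).

Definition quasi_pseudometric (R : realType) (X : Type) (d : X -> X -> R) :
  Prop :=
  [/\ forall x y, 0 <= d x y,
      forall x, d x x = 0 &
      forall x y z, d x z <= d x y + d y z].

Definition generated_quasi_uniformity (R : realType) (X A : Type)
    (d : A -> X -> X -> R) : set_system (X * X) :=
  smallest Filter
    [set V | exists a eps, 0 < eps /\ V = [set xy | d a xy.1 xy.2 < eps]].

Definition D_contraction (R : realType) (X A : Type) (d : A -> X -> X -> R)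
    (f : X -> X) : Prop :=
  exists k : A -> R,
    (forall a, 0 <= k a < 1) /\
    (forall a x y, d a (f x) (f y) <= k a * d a x y /\
                   d a (f y) (f x) <= k a * d a y x).

Definition selector (X : Type) (T : X -> set X) (f : X -> X) : Prop :=
  forall x, T x (f x).

Definition common_startpoint (X : Type) (U : set_system (X * X)) (n : nat)
    (T : 'I_n -> X -> set X) (x : X) (z : 'I_n -> X) : Prop :=
  forall i, T i x (z i) /\ qu_preorder U (x, z i).

(* Main.v *)
(** Contractivity makes every orbit of a contractive selector Cauchy for each
    [d a] in both arguments, so bicompleteness provides a limit, which is at
    [d a]-distance 0 from its image in both directions and hence, by T0, is a
    fixed point.  The same two-sided argument gives uniqueness.  If [f] and [g]
    commute then [g] preserves the set of fixed points of [f]; the unique fixed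
    point of [f] is therefore fixed by [g]. *)
Require Import Defs.
From mathcomp Require Import all_boot all_order all_algebra.
From mathcomp Require Import all_classical all_reals.
From mathcomp Require Import normedtype sequences lra.
Import Order.TTheory GRing.Theory Num.Theory numFieldNormedType.Exports.
Local Open Scope classical_set_scope.
Local Open Scope ring_scope.

Lemma near_geometric_lt {R : realType} {k : R} (M : R) {eps : R} :
  0 <= k < 1 -> 0 < eps ->
  exists N, forall n, (N <= n)%N -> k ^+ n * M < eps.
Proof.
move=> /andP[k0 k1] eps0.
have : geometric M k @ \oo --> (0 : R).
  by apply: cvg_geometric; rewrite ger0_norm.
move=> /cvgrPdist_lt /(_ _ eps0) [N _ hN].
exists N => n /hN /=; rewrite sub0r normrN mulrC.
exact: le_lt_trans (ler_norm _).
Qed.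

Section QuasiUniform.
Context {R : realType} {X A : Type} {d : A -> X -> X -> R}.
Hypothesis d_qpm : forall a, quasi_pseudometric (d a).

Let U := generated_quasi_uniformity d.

(** Serves as an induction principle: a property of entourages that defines a filter need only be
    checked on the subbasic balls. *)
Lemma generated_quasi_uniformity_sub (F : set_system (X * X)) : Filter F ->
  (forall a eps, 0 < eps -> F [set xy | d a xy.1 xy.2 < eps]) -> U `<=` F.
Proof.
move=> FF Fball; apply: smallest_sub => // _ [a [eps [eps0 ->]]].
exact: Fball.
Qed.

Lemma generated_quasi_uniformity_ball a eps : 0 < eps ->
  U [set xy | d a xy.1 xy.2 < eps].
Proof. by move=> eps0 F [_]; apply; exists a, eps. Qed.

Lemma qu_preorder_generated x y : (forall a, d a x y = 0) ->
  qu_preorder U (x, y).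
Proof.
(* The principal filter at the point [(x, y)] contains every ball, since [d a x y = 0 < eps]. *)
move=> dxy V /(@generated_quasi_uniformity_sub (globally [set (x, y)])).
by apply => // a eps eps0 _ ->; rewrite /= dxy.
Qed.

Lemma qu_T0_generated x y : qu_T0 U ->
  (forall a, d a x y = 0 /\ d a y x = 0) -> x = y.
Proof.
by move=> T0 dxy; apply: T0; apply: qu_preorder_generated => a; case: (dxy a).
Qed.

Lemma cauchy_net_generated (u : nat -> X) :
  (forall a eps, 0 < eps -> exists N, forall i j, (N <= i)%N -> (N <= j)%N ->
    d a (u i) (u j) < eps) ->
  cauchy_net (symmetrisation U) (fun i j => (i <= j)%N) u.
Proof.
move=> du W [V UV VW].
(* [F] consists of the sets containing all pairs from some tail of [u]. As [i] and [j] range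
   independently over the tail, swapping them handles the factor [V^-1]. *)
pose F : set_system (X * X) := fun V =>
  exists N, forall i j, (N <= i)%N -> (N <= j)%N -> V (u i, u j).
have [] : F V.
  apply: generated_quasi_uniformity_sub UV => //; split.
  - by exists 0%N.
  - move=> P Q [N1 P1] [N2 Q2]; exists (maxn N1 N2) => i j.
    by rewrite !geq_max => /andP[? ?] /andP[? ?]; split; [apply: P1|apply: Q2].
  - by move=> P Q PQ [N PN]; exists N => i j Ni Nj; apply/PQ/PN.
by move=> N VN; exists N => i j Ni Nj; apply: VW; split; apply: VN.
Qed.

Lemma net_cvg_to_generated (u : nat -> X) (x : X) :
  net_cvg_to (symmetrisation U) (fun i j => (i <= j)%N) u x ->
  forall a eps, 0 < eps -> exists N, forall i, (N <= i)%N ->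
    d a x (u i) < eps /\ d a (u i) x < eps.
Proof.
move=> ux a eps eps0.
have [] := ux ([set xy | d a xy.1 xy.2 < eps] `&`
               [set xy | d a xy.1 xy.2 < eps]^-1)%relation.
  by eexists; first exact: (generated_quasi_uniformity_ball a eps).
by move=> N uN; exists N => i /uN.
Qed.

Section Contraction.
Context {f : X -> X}.
Hypothesis f_contraction : D_contraction d f.

(** At two fixed points the contraction inequality reads [t <= k a * t] with [k a < 1], which forces
    both directed distances to vanish. *)
Lemma contraction_fixed_point_unique x y : qu_T0 U ->
  f x = x -> f y = y -> x = y.
Proof.
move=> T0 fx fy; have [k [k01 fk]] := f_contraction.
apply: qu_T0_generated => // a; have [d0 _ _] := d_qpm a.
have /andP[k0 k1] := k01 a; have := d0 x y; have := d0 y x.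
by have [] := fk a x y; rewrite fx fy => *; split; nra.
Qed.

(* The bound [M = D / (1 - k)] with [D = max (d x (f x)) (d (f x) x)] solves
   [D + k * M = M], so it propagates along the orbit. *)
Lemma contraction_orbit_bounded a x : exists M, forall m,
  d a x (iter m f x) <= M /\ d a (iter m f x) x <= M.
Proof.
have [k [k01 fk]] := f_contraction; have /andP[k0 k1] := k01 a.
have [d0 dxx dtri] := d_qpm a.
pose D := Num.max (d a x (f x)) (d a (f x) x).
have D1 : d a x (f x) <= D by rewrite le_max lexx.
have D2 : d a (f x) x <= D by rewrite le_max lexx orbT.
have k1' : 0 < 1 - k a by rewrite subr_gt0.
have D0 : 0 <= D := le_trans (d0 _ _) D1.
exists (D / (1 - k a)); set M := D / _.
have ME : D + k a * M = M.
  by have : M * (1 - k a) = D by [rewrite mulfVK ?gt_eqF|]; lra.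
have M0 : 0 <= M by rewrite divr_ge0 // ltW.
elim=> [|m [IH1 IH2]]; first by rewrite /= dxx.
rewrite iterS; have [F1 F2] := fk a x (iter m f x).
have H1 := ler_wpM2l k0 IH1; have H2 := ler_wpM2l k0 IH2.
(* Detour through [f x]: one leg costs at most [D], and the contraction bounds the other by
   [k a * M]. *)
have T1 := dtri x (f x) (f (iter m f x)).
have T2 := dtri (f (iter m f x)) (f x) x.
by split; lra.
Qed.

Lemma contraction_orbit_cauchy x :
  cauchy_net (symmetrisation U) (fun i j => (i <= j)%N) (fun i => iter i f x).
Proof.
apply: cauchy_net_generated => a eps eps0.
have [k [k01 fk]] := f_contraction; have /andP[k0 k1] := k01 a.
have [M dM] := contraction_orbit_bounded a x.
have shift i y z : d a (iter i f y) (iter i f z) <= k a ^+ i * d a y z.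
  elim: i => [|i IH]; first by rewrite mul1r.
  rewrite !iterS exprS -mulrA.
  by apply: le_trans (proj1 (fk a _ _)) _; rewrite ler_wpM2l.
have [N kN] := near_geometric_lt M (k01 a) eps0.
(* Pulling out the smaller iterate leaves a distance between [x] and a point of its orbit, at most
   [M]. The two orders of [i] and [j] use the two directions of that bound, as [d a] need not be
   symmetric. *)
exists N => i j Ni Nj; have [ij|/ltnW ji] := leqP i j.
- rewrite -(subnKC ij) iterD; apply: le_lt_trans (kN _ Ni).
  by apply: le_trans (shift _ _ _) _; rewrite ler_wpM2l ?exprn_ge0 ?(dM _).1.
- rewrite -(subnKC ji) iterD; apply: le_lt_trans (kN _ Nj).
  by apply: le_trans (shift _ _ _) _; rewrite ler_wpM2l ?exprn_ge0 ?(dM _).2.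
Qed.

Lemma contraction_fixed_point_exists : [set: X] !=set0 -> qu_T0 U ->
  bicomplete U -> exists x, f x = x.
Proof.
move=> [x0 _] T0 Ucomplete; have [k [k01 fk]] := f_contraction.
have dir : directed_preorder (fun i j => (i <= j)%N).
  split=> // [|i j l|i j]; first exact: (inhabits 0%N).
    exact: leq_trans.
  by exists (maxn i j); rewrite ?leq_maxl ?leq_maxr.
have [x /net_cvg_to_generated ux] :=
  Ucomplete _ _ _ dir (contraction_orbit_cauchy x0).
exists x; apply: qu_T0_generated => // a.
have [d0 _ dtri] := d_qpm a; have /andP[k0 k1] := k01 a.
suff H eps : 0 < eps -> d a (f x) x <= eps /\ d a x (f x) <= eps.
  by split; apply/le_anti; rewrite d0 andbT; apply/ler_addgt0Pr => e /H;
    rewrite add0r => -[].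
(* Both [y], the [N]-th iterate, and its successor [f y] lie within [eps / 2] of [x] in each
   direction. The triangle inequality through [f y], with [d a (f x) (f y) <= d a x y] and its
   reverse, adds up to [eps]. *)
move=> eps0; have [N uN] := ux a (eps / 2) (divr_gt0 eps0 (ltr0Sn _ _)).
have [h1 h2] := uN N (leqnn N); have [h3 h4] := uN N.+1 (leqnSn N).
move: h3 h4; rewrite iterS; set y := iter N f x0 in h1 h2 *.
have [F1 F2] := fk a x y.
have T1 := dtri (f x) (f y) x; have T2 := dtri x (f y) (f x).
have P1 := ler_piMl (d0 x y) (ltW k1); have P2 := ler_piMl (d0 y x) (ltW k1).
by move=> h3 h4; split; lra.
Qed.

End Contraction.
End QuasiUniform.

Theorem theorem7p2 (R : realType) (X : Type) (U : set_system (X * X))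
    (A : Type) (d : A -> X -> X -> R)
    (n : nat) (T : 'I_n -> X -> set X) (f : 'I_n -> X -> X)
    (X_nonempty : [set: X] !=set0)
    (U_qu : quasi_uniformity U)
    (U_T0 : qu_T0 U)
    (U_bicomplete : bicomplete U)
    (d_qpm : forall a, quasi_pseudometric (d a))
    (U_generated : U = generated_quasi_uniformity d)
    (n_gt0 : (0 < n)%N)
    (T_nonempty : forall i x, T i x !=set0)
    (f_selector : forall i, selector (T i) (f i))
    (f_contraction : forall i, D_contraction d (f i)) :
  (forall i, exists! x, f i x = x) /\
  ((forall i j x, f i (f j x) = f j (f i x)) ->
   forall xs : 'I_n -> X, (forall i, f i (xs i) = xs i) ->
   exists x, (forall i, xs i = x) /\ common_startpoint U T x (fun=> x)).
Proof.
have uniq i x y : f i x = x -> f i y = y -> x = y.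
  by move: U_T0; rewrite U_generated; apply: contraction_fixed_point_unique.
split=> [i|f_comm xs f_xs].
  have [x fx] : exists x, f i x = x.
    by move: U_T0 U_bicomplete; rewrite U_generated;
      apply: contraction_fixed_point_exists.
  by exists x; split=> // y; apply: uniq.
have xs_eq i j : xs i = xs j.
  (* By commutation [f j (xs i)] is again fixed by [f i], hence equals [xs i]; so [xs i] is fixed by
     [f j] as well. *)
  apply: (uniq j) => //; apply: (uniq i) => //.
  by rewrite f_comm f_xs.
(* The selector evaluated at its own fixed point puts that point in [T i x]. With witness [x]
   itself, the preorder condition is that [(x, x)] lies in every entourage. *)
exists (xs (Ordinal n_gt0)); split=> // i; split.
  by rewrite (xs_eq _ i) -{2}(f_xs i); apply: f_selector.
by case: U_qu => _ Udiag _ V /Udiag; apply.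
Qed.
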